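(* Let $n\ge 3$ be odd and put $M=(n-1)^{n-1}$. Suppose that for every integer $x\ge 1$ $$\sum_{j=0}^{\frac{n-1}{2}}(-1)^j\binom{n}{2j+1}S_{n,0}\big((n-1)^{2j}x\big)=\sum_{j=0}^{n-1}S_{n,j}(x).$$ Let $J\subseteq\{1,2,\dots,\frac{n-3}{2}\}$ be any subset (possibly empty). For integers $x\ge 0$ and $0\le j\le \frac{n-3}{2}$ put $T_j(x)=S_{n,0}\big(\lfloor x/(n-1)^{n-1-2j}\rfloor\big)$ if $j\in J$ and $T_j(x)=S_{n,0}\big((n-1)^{2j}\lfloor x/M\rfloor\big)$ if $j\notin J$, and let $$\Sigma_J(x)=\sum_{j=0}^{\frac{n-3}{2}}(-1)^{\frac{n-3}{2}-j}\binom{n}{2j+1}T_j(x).$$ Define $\nu_n^{J}(x)=S_{n,0}(x)-\Sigma_J(x)$. Then the sequence $\big((-1)^{s_{n-1}(x)}\nu_n^{J}(x)\big)_{x\ge 0}$ is periodic with period $2n(n-1)^{n-1}$.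
   Context: For an integer $b\ge 2$ and integer $r\ge 0$, $s_b(r)$ denotes the sum of the digits of $r$ in base $b$. For integers $n\ge 3$, $0\le j\le n-1$ and $x\ge 0$, define $$S_{n,j}(x)=\sum_{0\le r<x,\; r\equiv j \pmod n}(-1)^{s_{n-1}(r)}.$$ *)

(* Defs.v *)
From mathcomp Require Import all_boot all_order all_algebra.

Set Implicit Arguments.
Unset Strict Implicit.
Unset Printing Implicit Defensive.

Import GRing.Theory.
Local Open Scope ring_scope.

(* The digit of index i of r in base b is (r %/ b ^ i) %% b; for b >= 2 it
   vanishes as soon as i >= r, because r < b ^ r, so r indices are enough. *)
Definition digit_sum (b r : nat) : nat :=
  (\sum_(0 <= i < r) (r %/ b ^ i) %% b)%N.

Definition Snj (n j x : nat) : int :=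
  \sum_(0 <= r < x | r == j %[mod n]) (-1) ^+ digit_sum n.-1 r.

Definition Tj (n : nat) (J : {pred nat}) (j x : nat) : int :=
  if j \in J then Snj n 0 (x %/ n.-1 ^ (n.-1 - 2 * j))
  else Snj n 0 (n.-1 ^ (2 * j) * (x %/ n.-1 ^ n.-1)).

Definition SigmaJ (n : nat) (J : {pred nat}) (x : nat) : int :=
  \sum_(0 <= j < (n - 3)./2.+1)
     (-1) ^+ ((n - 3)./2 - j) * 'C(n, 2 * j + 1)%:Z * Tj n J j x.

Definition nuJ (n : nat) (J : {pred nat}) (x : nat) : int :=
  Snj n 0 x - SigmaJ n J x.

(* Main.v *)
(* Put b = n - 1, which is even, M = b ^ b and sg r = (-1) ^ s_b(r).  Then nuJ x
   splits into differences S(x %/ b ^ (b - l)) - S(b ^ l * (x %/ M)) with l even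
   and into the error made at q = x %/ M when S(M q) is computed from the
   S(b ^ 2j q).  Appending digits multiplies signs and b ^ l = 1 modulo n, so
   each difference is sg q times a function of x mod M and q mod n; by the
   recurrence the error is, up to sign, \sum_(r < q) sg r, which telescopes to 0
   for even q and to - sg q for odd q.  As sg x = sg q * sg (x mod M), the
   product of sg x with either part depends only on x mod M and q mod 2 n. *)
Require Import Defs.
From mathcomp Require Import all_boot all_order all_algebra.
From mathcomp Require Import zify.

Set Implicit Arguments.
Unset Strict Implicit.
Unset Printing Implicit Defensive.

Import GRing.Theory.
Local Open Scope ring_scope.

Lemma sum_digits_widen (b r m p : nat) : (0 < b)%N -> (r < b ^ m)%N -> (m <= p)%N ->
  (\sum_(0 <= i < p) (r %/ b ^ i) %% b = \sum_(0 <= i < m) (r %/ b ^ i) %% b)%N.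
Proof.
move=> b_gt0 lt_r le_mp; rewrite (big_cat_nat _ le_mp) //=.
rewrite [X in (_ + X)%N]big_nat [X in (_ + X)%N]big1 ?addn0 // => i /andP[le_mi _].
by rewrite divn_small ?mod0n // (leq_trans lt_r) // leq_pexp2l.
Qed.

Lemma digit_sumE (b r m : nat) : (1 < b)%N -> (r < b ^ m)%N ->
  digit_sum b r = (\sum_(0 <= i < m) (r %/ b ^ i) %% b)%N.
Proof.
move=> b_gt1 lt_r; have b_gt0 := ltnW b_gt1.
rewrite /digit_sum -(sum_digits_widen b_gt0 (ltn_expl r b_gt1) (leq_maxl r m)).
exact: sum_digits_widen (leq_maxr r m).
Qed.

Lemma digit_sum_small (b d : nat) : (1 < b)%N -> (d < b)%N -> digit_sum b d = d.
Proof.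
by move=> b_gt1 lt_db; rewrite (@digit_sumE b d 1) // big_nat1 divn1 modn_small.
Qed.

Lemma digit_sum_cat (b k q t : nat) : (1 < b)%N -> (t < b ^ k)%N ->
  digit_sum b (b ^ k * q + t) = (digit_sum b q + digit_sum b t)%N.
Proof.
move=> b_gt1 lt_t; have b_gt0 := ltnW b_gt1.
have bk_gt0 : (0 < b ^ k)%N by rewrite expn_gt0 b_gt0.
have lt_q := ltn_expl q b_gt1.
have lt_cat : (b ^ k * q + t < b ^ (k + q))%N.
  rewrite expnD; apply: (@leq_trans (b ^ k * q.+1)); last first.
    by rewrite leq_mul2l lt_q orbT.
  by rewrite mulnSr ltn_add2l.
rewrite (digit_sumE b_gt1 lt_cat) (digit_sumE b_gt1 lt_t) (digit_sumE b_gt1 lt_q).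
rewrite (big_cat_nat _ (leq_addr q k)) //= addnC; congr (_ + _)%N.
  rewrite -{1}[k]add0n big_addn addKn; apply: eq_bigr => i _.
  by rewrite (addnC i) expnD divnMA [(_ * q)%N]mulnC divnMDl // (divn_small lt_t) addn0.
apply: eq_big_nat => i /= lt_ik.
have -> : (b ^ k = b ^ (k - i.+1) * b * b ^ i)%N.
  by rewrite -expnSr -expnD; congr expn; lia.
by rewrite (mulnAC _ _ q) divnMDl ?expn_gt0 ?b_gt0 // mulnAC modnMDl.
Qed.

Definition digit_sign (b r : nat) : int := (-1) ^+ digit_sum b r.

Lemma digit_sign_sqr (b r : nat) : digit_sign b r * digit_sign b r = 1.
Proof. by rewrite -expr2 sqrr_sign. Qed.

Lemma digit_sign_cat (b k q t : nat) : (1 < b)%N -> (t < b ^ k)%N ->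
  digit_sign b (b ^ k * q + t) = digit_sign b q * digit_sign b t.
Proof. by move=> b_gt1 lt_t; rewrite /digit_sign digit_sum_cat // exprD. Qed.

Lemma digit_sign_divn_modn (b k x : nat) : (1 < b)%N ->
  digit_sign b x = digit_sign b (x %/ b ^ k) * digit_sign b (x %% b ^ k).
Proof.
move=> b_gt1; rewrite -(digit_sign_cat (k := k)) //; first by rewrite mulnC -divn_eq.
by rewrite ltn_mod expn_gt0 (ltnW b_gt1).
Qed.

Lemma digit_sign_succ_even (b q : nat) : (1 < b)%N -> ~~ odd b -> ~~ odd q ->
  digit_sign b q.+1 = - digit_sign b q.
Proof.
move=> b_gt1 b_even q_even.
have d_even : ~~ odd (q %% b) by rewrite odd_mod //; apply: negbTE.
have lt_db : (q %% b < b)%N by rewrite ltn_mod ltnW.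
have lt_Sdb : ((q %% b).+1 < b)%N by lia.
have -> : q.+1 = (b ^ 1 * (q %/ b) + (q %% b).+1)%N.
  by rewrite addnS mulnC -divn_eq.
rewrite digit_sign_cat // (digit_sign_divn_modn 1 q b_gt1) -mulrN; congr (_ * _).
by rewrite /digit_sign !digit_sum_small // exprS mulN1r.
Qed.

Lemma sum_digit_sign (b q : nat) : (1 < b)%N -> ~~ odd b ->
  \sum_(0 <= r < q) digit_sign b r = - (digit_sign b q * (odd q)%:Z).
Proof.
move=> b_gt1 b_even; elim: q => [|q IHq]; first by rewrite big_geq // mulr0 oppr0.
rewrite big_nat_recr //= {}IHq.
have [q_odd|q_even] /= := boolP (odd q); first by rewrite mulr1 mulr0 addNr oppr0.
by rewrite digit_sign_succ_even // mulr0 mulr1 oppr0 add0r opprK.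
Qed.

Lemma sum_digit_sign_block (b k q t : nat) (P : pred nat) :
    (1 < b)%N -> (t <= b ^ k)%N ->
  \sum_(b ^ k * q <= r < b ^ k * q + t | P r) digit_sign b r =
    digit_sign b q * \sum_(0 <= r < t | P (b ^ k * q + r)%N) digit_sign b r.
Proof.
move=> b_gt1 le_t; rewrite mulr_sumr -{1}[(b ^ k * q)%N]add0n big_addn addKn.
under eq_bigl do rewrite addnC.
rewrite big_nat_cond [RHS]big_nat_cond; apply: eq_bigr => r /andP[/andP[_ lt_rt] _].
by rewrite addnC digit_sign_cat // (leq_trans lt_rt).
Qed.

Definition sign_periodic (b p : nat) (f : nat -> int) : Prop :=
  forall x, digit_sign b (x + p) * f (x + p)%N = digit_sign b x * f x.

Section SignPeriodic.

Variables b p : nat.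
Implicit Types f g : nat -> int.

Lemma eq_sign_periodic f g : f =1 g -> sign_periodic b p f -> sign_periodic b p g.
Proof. by move=> eq_fg f_per x; rewrite -!eq_fg. Qed.

Lemma sign_periodicD f g : sign_periodic b p f -> sign_periodic b p g ->
  sign_periodic b p (fun x => f x + g x).
Proof. by move=> f_per g_per x; rewrite !mulrDr f_per g_per. Qed.

Lemma sign_periodicB f g : sign_periodic b p f -> sign_periodic b p g ->
  sign_periodic b p (fun x => f x - g x).
Proof. by move=> f_per g_per x; rewrite !mulrBr f_per g_per. Qed.

Lemma sign_periodicZ (c : int) f : sign_periodic b p f ->
  sign_periodic b p (fun x => c * f x).
Proof. by move=> f_per x; rewrite !(mulrCA _ c) f_per. Qed.

Lemma sign_periodic_sum (I : Type) (s : seq I) (P : pred I) (F : I -> nat -> int) :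
  (forall i, P i -> sign_periodic b p (F i)) ->
  sign_periodic b p (fun x => \sum_(i <- s | P i) F i x).
Proof. by move=> F_per x; rewrite !mulr_sumr; apply: eq_bigr => i /F_per. Qed.

Lemma sign_periodic_mul (m : nat) f : sign_periodic b p f -> sign_periodic b (m * p) f.
Proof.
by move=> f_per x; elim: m => [|m IHm]; rewrite ?addn0 // mulSnr addnA f_per.
Qed.

Lemma sign_periodic_block (k : nat) (g : nat -> nat -> int) : (1 < b)%N ->
    (forall q t, g (q + p)%N t = g q t) ->
  sign_periodic b (p * b ^ k)
    (fun x => digit_sign b (x %/ b ^ k) * g (x %/ b ^ k)%N (x %% b ^ k)%N).
Proof.
move=> b_gt1 g_per.
have sign_cancel x : digit_sign b x
    * (digit_sign b (x %/ b ^ k) * g (x %/ b ^ k)%N (x %% b ^ k)%N)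
    = digit_sign b (x %% b ^ k) * g (x %/ b ^ k)%N (x %% b ^ k)%N.
  by rewrite (digit_sign_divn_modn k x) // mulrACA mulrA digit_sign_sqr mul1r.
move=> x; rewrite !{}sign_cancel addnC modnMDl divnMDl ?expn_gt0 ?(ltnW b_gt1) //.
by rewrite addnC g_per.
Qed.

End SignPeriodic.

Lemma predn_expn_even_mod (n k : nat) : (0 < n)%N -> ~~ odd k ->
  (n.-1 ^ k = 1 %[mod n])%N.
Proof.
case: n => // n _ k_even; rewrite -(even_halfK k_even) -mul2n expnM -modnXm.
suff -> : (n ^ 2 = 1 %[mod n.+1])%N by rewrite modnXm exp1n.
case: n => [|n]; first by rewrite !modn1.
by rewrite /= (_ : n.+1 ^ 2 = n * n.+2 + 1)%N ?modnMDl //; lia.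
Qed.

Lemma divn_expn_split (b k l x : nat) : (0 < b)%N -> (l <= k)%N ->
  (x %/ b ^ (k - l) = b ^ l * (x %/ b ^ k) + (x %% b ^ k) %/ b ^ (k - l))%N.
Proof.
move=> b_gt0 le_lk; rewrite {1}(divn_eq x (b ^ k)).
have -> : (b ^ k = b ^ l * b ^ (k - l))%N by rewrite -expnD subnKC.
by rewrite mulnA divnMDl ?expn_gt0 ?b_gt0 // mulnC.
Qed.

Definition shifted_Snj (n j a t : nat) : int :=
  \sum_(0 <= r < t | a + r == j %[mod n]) digit_sign n.-1 r.

Lemma shifted_Snj_period (n j a t : nat) :
  shifted_Snj n j (a + n) t = shifted_Snj n j a t.
Proof. by apply: eq_bigl => r; rewrite addnAC modnDr. Qed.

Lemma Snj_cat (n j k q t : nat) : (2 < n)%N -> ~~ odd k -> (t <= n.-1 ^ k)%N ->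
  Snj n j (n.-1 ^ k * q + t) =
    Snj n j (n.-1 ^ k * q) + digit_sign n.-1 q * shifted_Snj n j q t.
Proof.
move=> n_gt2 k_even le_t.
rewrite /Snj (big_cat_nat _ (leq_addr t (n.-1 ^ k * q))) //=; congr (_ + _).
rewrite sum_digit_sign_block //; last by lia.
congr (_ * _); apply: eq_bigl => r; congr (_ == _).
rewrite -modnDml -modnMml predn_expn_even_mod //; last by lia.
by rewrite modnMml mul1n modnDml.
Qed.

Definition Snj_floor_gap (n j k l x : nat) : int :=
  Snj n j (x %/ n.-1 ^ (k - l)) - Snj n j (n.-1 ^ l * (x %/ n.-1 ^ k)).

Lemma Snj_floor_gapE (n j k l x : nat) : (2 < n)%N -> ~~ odd l -> (l <= k)%N ->
  Snj_floor_gap n j k l x =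
    digit_sign n.-1 (x %/ n.-1 ^ k)
      * shifted_Snj n j (x %/ n.-1 ^ k) (x %% n.-1 ^ k %/ n.-1 ^ (k - l)).
Proof.
move=> n_gt2 l_even le_lk; have b_gt0 : (0 < n.-1)%N by lia.
rewrite /Snj_floor_gap (divn_expn_split x b_gt0 le_lk) Snj_cat // 1?addrC ?addKr //.
rewrite ltnW // ltn_divLR ?expn_gt0 ?b_gt0 // -expnD subnKC //.
by rewrite ltn_mod expn_gt0 b_gt0.
Qed.

Lemma sign_periodic_floor_gap (n j k l : nat) : (2 < n)%N -> ~~ odd l -> (l <= k)%N ->
  sign_periodic n.-1 (n * n.-1 ^ k) (Snj_floor_gap n j k l).
Proof.
move=> n_gt2 l_even le_lk.
apply: eq_sign_periodic => [x|]; first by rewrite Snj_floor_gapE.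
apply: (@sign_periodic_block _ _ k
  (fun q t => shifted_Snj n j q (t %/ n.-1 ^ (k - l)))) => [|q t]; first by lia.
exact: shifted_Snj_period.
Qed.

Lemma sum_residue_classes (V : nmodType) (n x : nat) (F : nat -> V) : (0 < n)%N ->
  \sum_(0 <= j < n) \sum_(0 <= r < x | r == j %[mod n]) F r = \sum_(0 <= r < x) F r.
Proof.
move=> n_gt0; under eq_bigr do rewrite big_mkcond /=.
rewrite exchange_big /=; apply: eq_bigr => r _.
have lt_rn : (r %% n < n)%N by rewrite ltn_mod.
rewrite -big_mkcond big_mkord (big_pred1 (Ordinal lt_rn)) // => j.
by rewrite /= -val_eqE /= (modn_small (ltn_ord j)) eq_sym.
Qed.

Lemma alternating_sum_recr (R : pzRingType) (m : nat) (F : nat -> R) :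
  \sum_(0 <= j < m.+2) (-1) ^+ j * F j =
    (-1) ^+ m.+1 * (F m.+1 - \sum_(0 <= j < m.+1) (-1) ^+ (m - j) * F j).
Proof.
rewrite big_nat_recr //= addrC mulrBr; congr (_ + _).
rewrite mulr_sumr -sumrN; apply: eq_big_nat => j /andP[_ le_jm].
rewrite mulrA -exprD -mulNr; congr (_ * _).
have -> : (m.+1 + (m - j) = (m - j).*2 + j.+1)%N by lia.
by rewrite exprD -(signr_odd _ (m - j).*2) odd_double mul1r exprS mulN1r opprK.
Qed.

Definition SigmaJ_coef (n j : nat) : int :=
  (-1) ^+ ((n - 3)./2 - j) * 'C(n, 2 * j + 1)%:Z.

Definition recurrence_defect (n q : nat) : int :=
  Snj n 0 (n.-1 ^ n.-1 * q)
  - \sum_(0 <= j < (n - 3)./2.+1) SigmaJ_coef n j * Snj n 0 (n.-1 ^ (2 * j) * q).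

Lemma nuJ_decomposition (n : nat) (J : {pred nat}) (x : nat) :
  nuJ n J x =
    Snj_floor_gap n 0 n.-1 n.-1 x + recurrence_defect n (x %/ n.-1 ^ n.-1)
    - \sum_(0 <= j < (n - 3)./2.+1 | j \in J)
        SigmaJ_coef n j * Snj_floor_gap n 0 n.-1 (2 * j) x.
Proof.
rewrite /nuJ /Snj_floor_gap subnn divn1 /recurrence_defect addrA subrK.
rewrite -addrA -opprD; congr (_ - _).
rewrite [X in _ + X]big_mkcond -big_split /=; apply: eq_bigr => j _.
rewrite /Tj -/(SigmaJ_coef n j); case: ifP => _; last by rewrite addr0.
by rewrite -mulrDr subrKC.
Qed.

Section BinomialRecurrence.

Variable n : nat.
Hypotheses (n_gt2 : (2 < n)%N) (n_odd : odd n).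
Hypothesis recS : forall x : nat, (1 <= x)%N ->
  \sum_(0 <= j < n.-1./2.+1)
     (-1) ^+ j * 'C(n, 2 * j + 1)%:Z * Snj n 0 (n.-1 ^ (2 * j) * x)
  = \sum_(0 <= j < n) Snj n j x.

Lemma recurrence_defect_sum (q : nat) :
  recurrence_defect n q = (-1) ^+ n.-1./2 * \sum_(0 <= r < q) digit_sign n.-1 r.
Proof.
have [->|q_gt0] := posnP q.
  have Snj00 : Snj n 0 0 = 0 by rewrite /Snj big_geq.
  rewrite big_geq // mulr0 /recurrence_defect muln0 Snj00 big1 ?subr0 // => j _.
  by rewrite muln0 Snj00 mulr0.
have n_gt0 : (0 < n)%N by lia.
have half_eq : n.-1./2 = (n - 3)./2.+1 by lia.
have top_eq : (2 * (n - 3)./2.+1 = n.-1)%N by lia.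
rewrite -(sum_residue_classes q _ n_gt0) -recS // half_eq.
under [in RHS]eq_bigr do rewrite -mulrA.
rewrite (alternating_sum_recr _
  (fun j => 'C(n, 2 * j + 1)%:Z * Snj n 0 (n.-1 ^ (2 * j) * q))).
rewrite top_eq addn1 prednK // binn mul1r mulrA -expr2 sqrr_sign mul1r.
by under [in RHS]eq_bigr do rewrite mulrA.
Qed.

Lemma sign_periodic_recurrence_defect :
  sign_periodic n.-1 (2 * n.-1 ^ n.-1)
    (fun x => recurrence_defect n (x %/ n.-1 ^ n.-1)).
Proof.
have b_gt1 : (1 < n.-1)%N by lia.
have b_even : ~~ odd n.-1 by lia.
pose parity_defect (q t : nat) : int := (-1) ^+ n.-1./2 * - (odd q)%:Z.
apply: eq_sign_periodic (@sign_periodic_block _ _ _ parity_defect b_gt1 _) => [x|q t].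
  by rewrite recurrence_defect_sum sum_digit_sign // -mulrN mulrCA.
by rewrite /parity_defect oddD addbF.
Qed.

End BinomialRecurrence.

Theorem theorem10 (n : nat) (n_ge3 : (3 <= n)%N) (n_odd : odd n)
  (recS : forall x : nat, (1 <= x)%N ->
     \sum_(0 <= j < n.-1./2.+1)
        (-1) ^+ j * 'C(n, 2 * j + 1)%:Z * Snj n 0 (n.-1 ^ (2 * j) * x)
     = \sum_(0 <= j < n) Snj n j x)
  (J : {pred nat})
  (J_sub : forall j : nat, j \in J -> (1 <= j <= (n - 3)./2)%N) :
  forall x : nat,
    (-1) ^+ digit_sum n.-1 (x + 2 * n * n.-1 ^ n.-1)
      * nuJ n J (x + 2 * n * n.-1 ^ n.-1)
    = (-1) ^+ digit_sum n.-1 x * nuJ n J x.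
Proof.
rewrite -/(sign_periodic n.-1 (2 * n * n.-1 ^ n.-1) (nuJ n J)).
have gap_periodic l : ~~ odd l -> (l <= n.-1)%N ->
    sign_periodic n.-1 (2 * n * n.-1 ^ n.-1) (Snj_floor_gap n 0 n.-1 l).
  by move=> l_even le_l; rewrite -mulnA;
    apply/sign_periodic_mul/sign_periodic_floor_gap.
apply: eq_sign_periodic => [x|]; first exact/esym/nuJ_decomposition.
apply: sign_periodicB; first apply: sign_periodicD.
- by apply: gap_periodic => //; lia.
- by rewrite mulnAC mulnC; apply/sign_periodic_mul/sign_periodic_recurrence_defect.
- apply: sign_periodic_sum => j /J_sub le_j.
  by apply/sign_periodicZ/gap_periodic; lia.
Qed.
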